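(* Let $n\ge 2$ be an integer, let $M$ be a real $2\times 2$ matrix with (real or complex) eigenvalues $\sigma_1,\sigma_2$, and let $\mathbf{w}\in\mathbb{R}^2$, $\mathbf{w}\neq\mathbf{0}$. For $t\in[0,1]$ put $T=T(t)=(1-t)\mathbb{I}+tM$ and $\sigma_k(t)=(1-t)+t\sigma_k$, $k=1,2$ (the eigenvalues of $T$). Then the curvature $\kappa$ of the planar Bézier curve of degree $n$ generated by $M$ and $\mathbf{w}$ is given, at every $t\in[0,1]$ at which it is defined, by $$\kappa(t)=\kappa(0)\,\frac{\bigl(\sigma_1(t)\sigma_2(t)\bigr)^{n-2}\,\Vert\mathbf{w}\Vert^3}{\Vert T^{n-1}\mathbf{w}\Vert^3},$$ where $\kappa(0)$ is the curvature at $t=0$. Moreover, write $\mathbf{w}=\mu_1\mathbf{v}_1+\mu_2\mathbf{v}_2$ in a basis $\{\mathbf{v}_1,\mathbf{v}_2\}$ of eigenvectors of $M$ (if $M$ is diagonalizable) or in a Jordan basis of $M$ (if $M$ is not diagonalizable), as described in the context. If $M$ is diagonalizable, then $$\kappa(0)=\frac{n-1}{n}\,\frac{\mu_1\mu_2(\sigma_2-\sigma_1)\det(\mathbf{v}_1,\mathbf{v}_2)}{\Vert\mathbf{w}\Vert^3};$$ otherwise, $$\kappa(0)=-\frac{n-1}{n}\,\frac{\mu_2^2\,\det(\mathbf{v}_1,\mathbf{v}_2)}{\Vert\mathbf{w}\Vert^3}.$$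
   Context: Given a real $2\times2$ matrix $M$ and $\mathbf{w}\in\mathbb{R}^2\setminus\{\mathbf{0}\}$, the Bézier curve of degree $n$ generated by $M$ and $\mathbf{w}$ is $c(t)=\sum_{j=0}^n b_jB_j^n(t)$, $t\in[0,1]$, where $B_j^n(t)=\binom{n}{j}t^j(1-t)^{n-j}$ are the Bernstein polynomials and the control points $b_j\in\mathbb{R}^2$ satisfy $b_{j+1}-b_j=M^j\mathbf{w}$ for $j=0,\dots,n-1$ ($b_0$ is arbitrary). The (signed) curvature is $\kappa(t)=\det(c'(t),c''(t))/\Vert c'(t)\Vert^3$, defined where $c'(t)\ne\mathbf{0}$. ''Diagonalizable'' means diagonalizable over $\mathbb{C}$. If $M$ is diagonalizable, $\mathbf{v}_k$ is an eigenvector for $\sigma_k$ ($k=1,2$) with $\mathbf{v}_1,\mathbf{v}_2$ linearly independent. If the eigenvalues are real, $\mathbf{v}_k\in\mathbb{R}^2$ and $\mu_k\in\mathbb{R}$; if they are non-real, $\sigma_2=\overline{\sigma_1}$, $\mathbf{v}_2=\overline{\mathbf{v}_1}\in\mathbb{C}^2$ and $\mu_2=\overline{\mu_1}$. If $M$ is not diagonalizable, $\sigma=\sigma_1=\sigma_2$ is its unique (real) eigenvalue, and a Jordan basis is a basis $\{\mathbf{v}_1,\mathbf{v}_2\}$ of $\mathbb{R}^2$ in which $\mathbf{v}_1$ is an eigenvector of $M$ and $(M-\sigma\mathbb{I})\mathbf{v}_2=\mathbf{v}_1$. $\det(\mathbf{a},\mathbf{b})$ is the determinant of the $2\times2$ matrix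 with columns $\mathbf{a},\mathbf{b}$ (complex entries allowed), $\Vert\cdot\Vert$ is the Euclidean norm, and zeroth powers are equal to $1$. *)

(* Defs.v *)
From HB Require Import structures.
From mathcomp Require Import all_boot all_order all_algebra.
From mathcomp Require Import complex.
From mathcomp Require Import all_classical all_reals all_analysis.
Set Implicit Arguments.
Unset Strict Implicit.
Unset Printing Implicit Defensive.
Import Order.TTheory GRing.Theory Num.Theory.
Import numFieldNormedType.Exports.
Local Open Scope ring_scope.
Local Open Scope complex_scope.

Definition bernstein (R : realType) (n j : nat) (t : R) : R :=
  'C(n, j)%:R * t ^+ j * (1 - t) ^+ (n - j)%N.

(* The curve is given by its polynomial formula on the whole real line, so that
   the two-sided derivatives below make sense at t = 0 and t = 1, where they
   coincide with the one-sided derivatives of the curve restricted to [0, 1].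
   Only the control points b 0, ..., b n are used. *)
Definition bezier (R : realType) (n : nat) (b : nat -> 'cV[R]_2) (t : R) :
    'cV[R]_2 :=
  \sum_(j < n.+1) bernstein n j t *: b j.

Definition generated_by (R : realType) (n : nat) (M : 'M[R]_2) (w : 'cV[R]_2)
    (b : nat -> 'cV[R]_2) : Prop :=
  forall j : nat, (j < n)%N -> b j.+1 - b j = M ^+ j *m w.

(* The canonical norm `|v| on matrices is the sup norm. *)
Definition enorm (R : realType) (v : 'cV[R]_2) : R :=
  Num.sqrt (\sum_(i < 2) v i 0 ^+ 2).

Definition det2 (F : comNzRingType) (a b : 'cV[F]_2) : F :=
  \det (row_mx a b : 'M[F]_2).

(* Meaningful only where derive1 c t != 0; elsewhere it takes the junk value 0. *)
Definition curvature (R : realType) (c : R -> 'cV[R]_2) (t : R) : R :=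
  det2 (derive1 c t) (derive1n 2 c t) / enorm (derive1 c t) ^+ 3.

Definition complexify (R : realType) (m n : nat) (A : 'M[R]_(m, n)) :
    'M[R[i]]_(m, n) :=
  map_mx (real_complex R) A.

(* s1 and s2 are the eigenvalues of M, listed with algebraic multiplicity. *)
Definition eigenvalues (R : realType) (M : 'M[R]_2) (s1 s2 : R[i]) : Prop :=
  char_poly (complexify M) = ('X - s1%:P) * ('X - s2%:P).

(* Column eigenvectors; the library's eigenspace consists of row vectors. *)
Definition eigenvector (F : fieldType) (A : 'M[F]_2) (s : F) (v : 'cV[F]_2) :
    Prop :=
  v != 0 /\ A *m v = s *: v.

(* The coordinates of w in a basis of eigenvectors. All data live over R[i];
   they are real when both eigenvalues are real and form conjugate pairs
   otherwise. *)
Definition eigen_decomposition (R : realType) (M : 'M[R]_2) (w : 'cV[R]_2)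
    (s1 s2 : R[i]) (v1 v2 : 'cV[R[i]]_2) (m1 m2 : R[i]) : Prop :=
  [/\ eigenvector (complexify M) s1 v1,
      eigenvector (complexify M) s2 v2,
      free [:: v1; v2],
      complexify w = m1 *: v1 + m2 *: v2
    & if (s1 \is Num.real) && (s2 \is Num.real) then
        [/\ v1 \is a mxOver Num.real, v2 \is a mxOver Num.real,
            m1 \is Num.real & m2 \is Num.real]
      else
        [/\ s2 = s1^*, v2 = map_mx conjc v1 & m2 = m1^*] ].

Definition jordan_basis (R : realType) (M : 'M[R]_2) (s : R)
    (v1 v2 : 'cV[R]_2) : Prop :=
  [/\ basis_of fullv [:: v1; v2],
      eigenvector M s v1
    & (M - s%:M) *m v2 = v1].

(* Main.v *)
Require Import Defs.
From HB Require Import structures.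
From mathcomp Require Import all_boot all_order all_algebra.
From mathcomp Require Import complex.
From mathcomp Require Import all_classical all_reals all_analysis.
From mathcomp Require Import ring.
Set Implicit Arguments.
Unset Strict Implicit.
Unset Printing Implicit Defensive.
Import Order.TTheory GRing.Theory Num.Theory.
Import numFieldNormedType.Exports.
Local Open Scope ring_scope.
Local Open Scope complex_scope.

(** Differentiating a Bezier curve of degree [n] gives, up to the factor [n],
    the Bezier curve of degree [n - 1] on the differences of the control
    points.  Here these differences are [M ^+ j *m w], and the binomial theorem,
    in the form of de Casteljau's algorithm, sums them to powers of
    [T = (1 - t) I + t M]:
    - the velocity is [n T^(n-1) w];
    - the acceleration is [n (n - 1) T^(n-2) (M - I) w].

    In the determinant of these two vectors the common factor [T^(n-2)] comes
    out as [(det T)^(n-2)], leaving [det (T w, (M - I) w)].  Since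
    [T w = w + t (M - I) w], this is [det (w, (M - I) w) = det (w, M w)], which
    no longer depends on [t].  Hence ([curvature_generated])
      [kappa t = (n-1)/n * (det T)^(n-2) * det (w, M w) / |T^(n-1) w|^3],
    and [t = 0], where [T = I], gives
    [kappa 0 = (n-1)/n * det (w, M w) / |w|^3].

    The theorem follows from two computations: [det T] is the product of the
    eigenvalues of [T] ([det_segment_mx]), and [det (w, M w)] in the coordinates
    of [w] is given by [det2_eigenvectors] for eigenvectors and by
    [det2_jordan_chain] for a Jordan basis. *)

(** * The Bezier curve and its derivatives *)

Section ProductRule.
Variables (R : realType) (V : normedModType R).
Local Open Scope classical_set_scope.

(** The product rule for the scalar [x] and a vector-valued function, read off
    from the identity
    [((t + h) f(t + h) - t f(t)) / h = f(t + h) + t (f(t + h) - f(t)) / h]. *)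
Lemma is_derive_scale_id (f : R -> V) (t : R) (df : V) :
  is_derive t 1 f df ->
  is_derive t 1 (fun x => x *: f x) (f t + t *: df).
Proof.
move=> [f_drv f_df].
have f_cont : {for t, continuous f}.
  by apply: differentiable_continuous; apply/derivable1_diffP.
suff quot_cvg : h^-1 *: ((h *: 1 + t) *: f (h *: 1 + t) - t *: f t)
    @[h --> 0^'] --> f t + t *: df.
  by split; [apply/cvg_ex; exists (f t + t *: df) | apply: cvg_lim].
have shift_cvg : f (h *: 1 + t) @[h --> 0^'] --> f t.
  have arg_cvg : h *: 1 + t @[h --> 0^'] --> t.
    rewrite -[X in _ --> X]add0r; apply: cvgD; last exact: cvg_cst.
    rewrite -[X in _ --> X](scale0r (1 : R)).
    by apply: cvgZr_tmp; apply: cvg_within.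
  exact: cvg_comp arg_cvg f_cont.
have slope_cvg : h^-1 *: (f (h *: 1 + t) - f t) @[h --> 0^'] --> df.
  by rewrite -f_df.
have sum_cvg := cvgD shift_cvg (cvgZl_tmp (k := t) slope_cvg).
apply: cvg_trans (sum_cvg _ _); apply: near_eq_cvg.
near=> h.
have h_neq0 : h != 0 by near: h; exact: nbhs_dnbhs_neq.
rewrite scalerDl -addrA -scalerBr scalerDr !scalerA.
rewrite [h *: 1]mulr1 mulVf // scale1r.
rewrite -[LHS]/(f (h *: 1 + t) + t *: (h^-1 *: (f (h *: 1 + t) - f t))).
by rewrite [h *: 1]mulr1 scalerA mulrC.
Unshelve. all: by end_near. Qed.

End ProductRule.

(** Pascal's rule.  At [j = n] the first summand vanishes with its binomial
    coefficient; the case is left out because there the truncated exponent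
    [n - j.+1] no longer drops by one. *)
Lemma bernstein_rec (R : realType) (n j : nat) (t : R) : (j < n)%N ->
  bernstein n.+1 j.+1 t = (1 - t) * bernstein n j.+1 t + t * bernstein n j t.
Proof.
move=> ltjn; rewrite /bernstein binS natrD subSS !exprS.
by rewrite -(subnSK ltjn) exprS; ring.
Qed.

Lemma eq_bezier (R : realType) (n : nat) (b b' : nat -> 'cV[R]_2) (t : R) :
  (forall j, (j <= n)%N -> b j = b' j) -> bezier n b t = bezier n b' t.
Proof. by move=> eq_b; apply: eq_bigr => j _; rewrite eq_b // -ltnS. Qed.

Lemma bezierB (R : realType) (n : nat) (b b' : nat -> 'cV[R]_2) (t : R) :
  bezier n (fun j => b j - b' j) t = bezier n b t - bezier n b' t.
Proof. by rewrite /bezier -sumrB; apply: eq_bigr => j _; rewrite scalerBr. Qed.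

Lemma mul_bezier (R : realType) (n : nat) (A : 'M[R]_2) b (t : R) :
  bezier n (fun j => A *m b j) t = A *m bezier n b t.
Proof.
by rewrite /bezier mulmx_sumr; apply: eq_bigr => j _; rewrite -scalemxAr.
Qed.

Lemma bezier0n (R : realType) (b : nat -> 'cV[R]_2) (t : R) :
  bezier 0 b t = b 0%N.
Proof. by rewrite /bezier big_ord1 /bernstein bin0 !expr0 !mulr1 scale1r. Qed.

Lemma de_casteljau (R : realType) (n : nat) (b : nat -> 'cV[R]_2) (t : R) :
  bezier n.+1 b t =
  (1 - t) *: bezier n b t + t *: bezier n (fun j => b j.+1) t.
Proof.
rewrite /bezier !scaler_sumr big_ord_recl big_ord_recr /=.
rewrite [X in _ = X + _]big_ord_recl [X in _ = _ + X]big_ord_recr /=.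
rewrite -[RHS]addrA; congr (_ + _).
  by rewrite scalerA /bernstein !bin0 !expr0 !subn0 exprS !mulr1 !mul1r.
rewrite [RHS]addrA -big_split /=; congr (_ + _); last first.
  by rewrite scalerA /bernstein !binn !subnn !expr0 exprS !mul1r !mulr1.
apply: eq_bigr => j _.
by rewrite !scalerA -scalerDl -bernstein_rec.
Qed.

(** De Casteljau's step in incremental form: raising the degree by one adds
    [t] times the curve of the differences, so that induction on the degree
    needs only the product rule for [t]. *)
Lemma bezierS (R : realType) (n : nat) (b : nat -> 'cV[R]_2) (t : R) :
  bezier n.+1 b t = bezier n b t + t *: bezier n (fun j => b j.+1 - b j) t.
Proof.
by rewrite de_casteljau bezierB scalerBl scalerBr scale1r addrAC addrA.
Qed.

(** In the inductive step, [bezierS] contributes one copy of the curve of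
    differences through the derivative of the factor [t]; the other two terms are
    recombined into [n] more copies by [bezierS] in one degree less.  In degree
    [0] the junk value [n.-1 = 0] is harmless because of the factor [n%:R]. *)
Lemma is_derive_bezier (R : realType) (n : nat) (b : nat -> 'cV[R]_2) (t : R) :
  is_derive t 1 (bezier n b)
    (n%:R *: bezier n.-1 (fun j => b j.+1 - b j) t).
Proof.
elim: n b => [|n IHn] b.
  have -> : bezier 0 b = cst (b 0%N) by apply/funext => x; rewrite bezier0n.
  by rewrite scale0r; exact: is_derive_cst.
have -> : bezier n.+1 b =
    bezier n b + (fun x => x *: bezier n (fun j => b j.+1 - b j) x).
  by apply/funext => x; rewrite bezierS.
apply: is_derive_eq (is_deriveD (IHn _) (is_derive_scale_id (IHn _))) _.
case: n {IHn} => [|n]; first by rewrite !scale0r scaler0 addr0 add0r scale1r.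
rewrite scalerA mulrC -scalerA addrCA -scalerDr.
by rewrite -bezierS -[n.+2]add1n natrD scalerDl scale1r.
Qed.

(** The factor [n.+1] is absorbed into the control points so that the
    derivative is again a Bezier curve, which can be differentiated once more. *)
Lemma derive1_bezier (R : realType) (n : nat) (b : nat -> 'cV[R]_2) :
  derive1 (bezier n.+1 b) =
  bezier n (fun j => n.+1%:R *: (b j.+1 - b j)).
Proof.
apply/funext => t; rewrite derive1E; have [_ ->] := is_derive_bezier n.+1 b t.
by rewrite /bezier scaler_sumr; apply: eq_bigr => j _; rewrite !scalerA mulrC.
Qed.

(** * Curves generated by a matrix *)

Definition segment_mx (R : realType) (M : 'M[R]_2) (t : R) : 'M[R]_2 :=
  (1 - t) *: 1%:M + t *: M.

(** De Casteljau's algorithm on the points [M ^+ j *m w]: shifting the index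
    is multiplication by [M], so each step multiplies by [(1 - t) I + t M]. *)
Lemma bezier_powers (R : realType) (n : nat) (M : 'M[R]_2) w (t : R) :
  bezier n (fun j => M ^+ j *m w) t = segment_mx M t ^+ n *m w.
Proof.
elim: n => [|n IHn]; first by rewrite bezier0n !expr0.
have -> : bezier n.+1 (fun j => M ^+ j *m w) t
    = (1 - t) *: bezier n (fun j => M ^+ j *m w) t
      + t *: (M *m bezier n (fun j => M ^+ j *m w) t).
  rewrite de_casteljau -mul_bezier; congr (_ + _ *: _).
  by apply: eq_bezier => j _; rewrite exprS mulmxA.
rewrite IHn exprS -mulmxA mulmxDl -!scalemxAl mul1mx.
by [].
Qed.

Lemma derive1_generated (R : realType) (n : nat) (M : 'M[R]_2) w b (t : R) :
  generated_by n.+1 M w b ->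
  derive1 (bezier n.+1 b) t = n.+1%:R *: (segment_mx M t ^+ n *m w).
Proof.
move=> gen_b; rewrite derive1_bezier scalemxAr -bezier_powers.
by apply: eq_bezier => j lejn; rewrite gen_b // scalemxAr.
Qed.

Lemma derive1n2_generated (R : realType) (n : nat) (M : 'M[R]_2) w b (t : R) :
  generated_by n.+2 M w b ->
  derive1n 2 (bezier n.+2 b) t =
  (n.+2%:R * n.+1%:R) *: (segment_mx M t ^+ n *m ((M - 1%:M) *m w)).
Proof.
move=> gen_b; rewrite derive1nS derive1n1 !derive1_bezier.
rewrite scalemxAr -bezier_powers; apply: eq_bezier => j lejn.
rewrite -scalerBr !gen_b ?ltnS 1?leqW // exprSr -mulmxA -mulmxBr.
by rewrite scalerA mulrC scalemxAr mulmxBl mul1mx.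
Qed.

(** * Planar determinants *)

Lemma det_mx22 (F : comNzRingType) (A : 'M[F]_2) :
  \det A = A 0 0 * A 1 1 - A 0 1 * A 1 0.
Proof.
rewrite (expand_det_row _ 0) !big_ord_recl big_ord0 /cofactor !det_mx11 !mxE /=.
have -> : lift (0 : 'I_2) (0 : 'I_1) = 1 by apply/val_inj.
have -> : lift (1 : 'I_2) (0 : 'I_1) = 0 by apply/val_inj.
by rewrite addn0 expr0 expr1; ring.
Qed.

Lemma det2E (F : comNzRingType) (a b : 'cV[F]_2) :
  det2 a b = a 0 0 * b 1 0 - a 1 0 * b 0 0.
Proof.
have left0 : 0 = lshift 1 (0 : 'I_1) :> 'I_2 by apply/val_inj.
have right1 : 1 = rshift 1 (0 : 'I_1) :> 'I_2 by apply/val_inj.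
have row_mx0 i : row_mx a b i 0 = a i 0 by rewrite [in LHS]left0 row_mxEl.
have row_mx1 i : row_mx a b i 1 = b i 0 by rewrite [in LHS]right1 row_mxEr.
by rewrite /det2 det_mx22 !row_mx0 !row_mx1 mulrC [b 0 0 * _]mulrC mulrC.
Qed.

Lemma det2ZZ (F : comNzRingType) (x y : F) (a b : 'cV[F]_2) :
  det2 (x *: a) (y *: b) = x * y * det2 a b.
Proof. by rewrite !det2E !mxE; ring. Qed.

Lemma det2_mul (F : comNzRingType) (A : 'M[F]_2) (a b : 'cV[F]_2) :
  det2 (A *m a) (A *m b) = \det A * det2 a b.
Proof. by rewrite /det2 -mul_mx_row det_mulmx. Qed.

Lemma det2_eigenvectors (F : comNzRingType) (A : 'M[F]_2) (v1 v2 : 'cV[F]_2)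
    (s1 s2 m1 m2 : F) :
  A *m v1 = s1 *: v1 -> A *m v2 = s2 *: v2 ->
  let w := m1 *: v1 + m2 *: v2 in
  det2 w (A *m w) = m1 * m2 * (s2 - s1) * det2 v1 v2.
Proof.
move=> eig1 eig2 /=; rewrite mulmxDr -!scalemxAr eig1 eig2 !det2E !mxE.
by ring.
Qed.

(** The sign comes from [A w] exceeding [s *: w] by [m2 *: v1], so that the
    basis vectors enter the determinant in the order [v2], [v1]. *)
Lemma det2_jordan_chain (F : comNzRingType) (A : 'M[F]_2) (v1 v2 : 'cV[F]_2)
    (s m1 m2 : F) :
  A *m v1 = s *: v1 -> A *m v2 = s *: v2 + v1 ->
  let w := m1 *: v1 + m2 *: v2 in
  det2 w (A *m w) = - (m2 ^+ 2 * det2 v1 v2).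
Proof.
move=> eig1 jordan2 /=; rewrite mulmxDr -!scalemxAr eig1 jordan2 !det2E !mxE.
by ring.
Qed.

(** This is the homogenized characteristic polynomial of [- A], hence
    determined by the trace and determinant of [A]. *)
Lemma det_linear_pencil (F : comNzRingType) (A : 'M[F]_2) (x y : F) :
  \det (x *: 1%:M + y *: A) = x ^+ 2 + x * y * \tr A + y ^+ 2 * \det A.
Proof.
rewrite !det_mx22 /mxtrace !big_ord_recl big_ord0 !mxE /=.
have -> : lift (0 : 'I_2) (0 : 'I_1) = 1 by apply/val_inj.
by ring.
Qed.

Lemma eigenvalues_trace_det (R : realType) (M : 'M[R]_2) (s1 s2 : R[i]) :
  eigenvalues M s1 s2 ->
  \tr (complexify M) = s1 + s2 /\ \det (complexify M) = s1 * s2.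
Proof.
move=> eig; have tr := char_poly_trace (complexify M) isT.
have det := char_poly_det (complexify M).
move: tr det; rewrite eig.
have -> : ('X - s1%:P) * ('X - s2%:P) = 'X^2 - (s1 + s2) *: 'X + (s1 * s2)%:P.
  by rewrite -mul_polyC rmorphD rmorphM /=; ring.
rewrite !coefE /= => tr det; split.
  by apply: oppr_inj; rewrite -tr add0r mulr1 addr0.
by rewrite -[LHS]mul1r -[1](sqrr_sign R[i] 1) expr1 -det mulr0 subr0 add0r.
Qed.

(** The trace and the determinant of [M] are the sum and the product of its
    eigenvalues, so [det_linear_pencil] factors. *)
Lemma det_segment_mx (R : realType) (M : 'M[R]_2) (s1 s2 : R[i]) (t : R) :
  eigenvalues M s1 s2 ->
  (\det (segment_mx M t))%:C =
  ((1 - t)%:C + t%:C * s1) * ((1 - t)%:C + t%:C * s2).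
Proof.
move=> /eigenvalues_trace_det[trM detM].
rewrite -det_map_mx -[map_mx _ _]/(complexify _).
have -> : complexify (segment_mx M t) =
    (1 - t)%:C *: 1%:M + t%:C *: complexify M.
  by rewrite /complexify /segment_mx map_mxD !map_mxZ map_mx1.
by rewrite det_linear_pencil trM detM; ring.
Qed.

Lemma complexify_mul (R : realType) (m n p : nat) (A : 'M[R]_(m, n))
    (B : 'M[R]_(n, p)) :
  complexify (A *m B) = complexify A *m complexify B.
Proof. exact: map_mxM. Qed.

Lemma complexify_det2 (R : realType) (a b : 'cV[R]_2) :
  (det2 a b)%:C = det2 (complexify a) (complexify b).
Proof. by rewrite !det2E !mxE rmorphB !rmorphM. Qed.

(** * Curvature *)

Lemma enormZ (R : realType) (a : R) (v : 'cV[R]_2) :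
  enorm (a *: v) = `|a| * enorm v.
Proof.
rewrite /enorm -sqrtr_sqr -sqrtrM ?sqr_ge0 // mulr_sumr; congr Num.sqrt.
by apply: eq_bigr => i _; rewrite mxE exprMn.
Qed.

Lemma enorm_neq0 (R : realType) (v : 'cV[R]_2) : v != 0 -> enorm v != 0.
Proof.
apply: contraNneq => /eqP; rewrite /enorm sqrtr_eq0 => le0.
have /eqP : \sum_(i < 2) v i 0 ^+ 2 = 0.
  by apply/eqP; rewrite eq_le le0 sumr_ge0 // => i _; rewrite sqr_ge0.
rewrite psumr_eq0 => [/allP v0|i _]; last exact: sqr_ge0.
apply/eqP/matrixP => i j; rewrite ord1 mxE; apply/eqP.
by rewrite -sqrf_eq0; apply: v0; rewrite mem_index_enum.
Qed.

(** The determinant of velocity and acceleration loses its dependence on [t]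
    up to the factor [\det (segment_mx M t) ^+ n], because [T w] and [w] differ by
    a multiple of [(M - I) w]. *)
Lemma curvature_generated (R : realType) (n : nat) (M : 'M[R]_2) w b (t : R) :
  generated_by n.+2 M w b ->
  curvature (bezier n.+2 b) t =
  n.+1%:R / n.+2%:R * (\det (segment_mx M t) ^+ n * det2 w (M *m w)
    / enorm (segment_mx M t ^+ n.+1 *m w) ^+ 3).
Proof.
move=> gen_b; set T := segment_mx M t.
rewrite /curvature (derive1_generated _ gen_b) (derive1n2_generated _ gen_b).
rewrite -/T enormZ ger0_norm //.
have velocity_acceleration :
    det2 (T ^+ n.+1 *m w) (T ^+ n *m ((M - 1%:M) *m w)) =
    \det T ^+ n * det2 w (M *m w).
  rewrite exprSr -mulmxA det2_mul.
  have -> : \det (T ^+ n) = \det T ^+ n.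
    elim: n {gen_b} => [|k IHk]; first by rewrite !expr0 det1.
    by rewrite !exprS det_mulmx IHk.
  have -> : T *m w = w + t *: ((M - 1%:M) *m w).
    rewrite /T /segment_mx scalerBl scale1r mulmxDl !mulmxBl -!scalemxAl.
    by rewrite !mul1mx scalerBr addrAC addrA.
  by rewrite mulmxBl mul1mx !det2E !mxE; ring.
rewrite -velocity_acceleration det2ZZ exprMn invfM.
have : n.+2%:R != 0 :> R by rewrite pnatr_eq0.
(* The norm may vanish: its inverse is kept opaque, out of reach of field. *)
move: (enorm _ ^+ 3)^-1 n.+2%:R => e a a_neq0.
by field.
Qed.

Lemma curvature_generated0 (R : realType) (n : nat) (M : 'M[R]_2) w b :
  generated_by n.+2 M w b ->
  curvature (bezier n.+2 b) 0 =
  n.+1%:R / n.+2%:R * (det2 w (M *m w) / enorm w ^+ 3).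
Proof.
move=> gen_b; rewrite (curvature_generated _ gen_b).
have -> : segment_mx M 0 = 1%:M.
  by rewrite /segment_mx subr0 scale1r scale0r addr0.
by rewrite det1 !expr1n mul1mx mul1r.
Qed.

Theorem theorem1 (R : realType) (n : nat) (M : 'M[R]_2) (s1 s2 : R[i])
    (w : 'cV[R]_2) (b : nat -> 'cV[R]_2) :
  (2 <= n)%N ->
  eigenvalues M s1 s2 ->
  w != 0 ->
  generated_by n M w b ->
  let c := bezier n b in
  let T := fun t : R => (1 - t) *: 1%:M + t *: M in
  let sigma1 := fun t : R => (1 - t)%:C + t%:C * s1 in
  let sigma2 := fun t : R => (1 - t)%:C + t%:C * s2 in
  [/\ forall t : R, 0 <= t <= 1 -> derive1 c t != 0 ->
        (curvature c t)%:C =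
          (curvature c 0)%:C *
          ((sigma1 t * sigma2 t) ^+ (n - 2)%N * (enorm w ^+ 3)%:C /
           (enorm (T t ^+ (n - 1)%N *m w) ^+ 3)%:C),
      diagonalizable (complexify M) ->
        forall (v1 v2 : 'cV[R[i]]_2) (m1 m2 : R[i]),
        eigen_decomposition M w s1 s2 v1 v2 m1 m2 ->
        (curvature c 0)%:C =
          (n%:R - 1) / n%:R *
          (m1 * m2 * (s2 - s1) * det2 v1 v2 / (enorm w ^+ 3)%:C)
    & ~ diagonalizable (complexify M) ->
        forall (s : R) (v1 v2 : 'cV[R]_2) (m1 m2 : R),
        s1 = s%:C -> s2 = s%:C ->
        jordan_basis M s v1 v2 ->
        w = m1 *: v1 + m2 *: v2 ->
        curvature c 0 =
          - ((n%:R - 1) / n%:R * (m2 ^+ 2 * det2 v1 v2 / enorm w ^+ 3)) ].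
Proof.
case: n => [|[|n]] // _ eig w_neq0 gen_b /=.
have norm_w : enorm w != 0 by exact: enorm_neq0.
have subn1R (F : pzRingType) : n.+2%:R - 1 = n.+1%:R :> F.
  by rewrite -[n.+2]addn1 natrD addrK.
have prefactorC : (n.+1%:R / n.+2%:R : R)%:C = n.+1%:R / n.+2%:R.
  by rewrite fmorph_div !rmorph_nat.
split.
- move=> t _ _; rewrite !subSS !subn0 -(det_segment_mx t eig).
  rewrite (curvature_generated0 gen_b) (curvature_generated t gen_b).
  rewrite -[(1 - t) *: _ + _]/(segment_mx M t) -rmorphXn -rmorphM /=.
  rewrite -fmorph_div -rmorphM /=; congr _%:C.
  rewrite -[RHS]mulrA; congr (_ * _).
  by move: (enorm (_ *m w) ^+ 3)^-1 => e; field.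
- move=> _ v1 v2 m1 m2 [[_ eig1] [_ eig2] _ w_dec _].
  rewrite (curvature_generated0 gen_b) subn1R rmorphM /= prefactorC.
  congr (_ * _); rewrite fmorph_div; congr (_ / _).
  apply: etrans (complexify_det2 _ _) _.
  by rewrite complexify_mul w_dec (det2_eigenvectors _ _ eig1 eig2).
- move=> _ s v1 v2 m1 m2 _ _ [_ [_ eig1] jordan2] w_dec.
  rewrite (curvature_generated0 gen_b) subn1R -mulrN -mulNr.
  congr (_ * (_ / _)).
  have Mv2 : M *m v2 = s *: v2 + v1.
    by rewrite -jordan2 mulmxBl mul_scalar_mx addrC subrK.
  by rewrite w_dec (det2_jordan_chain _ _ eig1).
Qed.
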